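(* Let $T$ be a tree of order $n\ge 3$ with diameter $d(T)$ and chromatic number $\chi(T)$. Then $$\max\{\chi(T),\lceil\log_2(d(T)+1)\rceil\}\le vcfc(T)\le \log_{3/2} n.$$
   Context: Vertex-colorings are arbitrary, not necessarily proper. A path in a vertex-colored graph is called conflict-free if there is a color used on exactly one of its vertices. A vertex-colored graph is conflict-free vertex-connected if any two vertices of the graph are connected by a conflict-free path. For a connected graph $G$, the conflict-free vertex-connection number $vcfc(G)$ is the smallest number of colors needed in a vertex-coloring of $G$ that makes $G$ conflict-free vertex-connected. *)

(* Defs.v *)
From HB Require Import structures.
From mathcomp Require Import all_boot all_order all_algebra.
From mathcomp Require Import all_classical reals exp.

Set Implicit Arguments.
Unset Strict Implicit.
Unset Printing Implicit Defensive.

Import Order.TTheory GRing.Theory Num.Theory.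

Record sgraph := SGraph {
  vertex :> finType;
  adj : rel vertex;
  adj_sym : symmetric adj;
  adj_irrefl : irreflexive adj
}.

(* [x :: p] is the vertex sequence of a path (no repeated vertex) from [x] to
   [y]; its length, the number of edges, is [size p]. *)
Definition is_path (G : sgraph) (x y : G) (p : seq G) : Prop :=
  [/\ path (@adj G) x p, last x p = y & uniq (x :: p)].

Definition connected (G : sgraph) : Prop :=
  forall x y : G, exists p, is_path x y p.

(* A cycle has at least three vertices: [[:: x; y]] with [x] adjacent to [y]
   satisfies [ucycle]. *)
Definition acyclic (G : sgraph) : Prop :=
  forall c : seq G, 2 < size c -> ~ ucycle (@adj G) c.

Definition is_tree (G : sgraph) : Prop := connected G /\ acyclic G.

(* The minimum of [P], with the default value 0 when [P] is empty. *)
Definition least (P : set nat) : nat :=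
  xget 0 [set k | P k /\ forall j, P j -> k <= j].

Definition dist (G : sgraph) (x y : G) : nat :=
  least [set k | exists2 p, is_path x y p & size p = k].

Definition diameter (G : sgraph) : nat :=
  \max_(x : G) \max_(y : G) dist x y.

Definition proper_coloring (G : sgraph) (k : nat) (c : G -> 'I_k) : Prop :=
  forall x y, adj x y -> c x != c y.

Definition chromatic_number (G : sgraph) : nat :=
  least [set k | exists c : G -> 'I_k, proper_coloring c].

Definition conflict_free (G : sgraph) (k : nat) (c : G -> 'I_k) (s : seq G) :
    Prop :=
  exists a : 'I_k, count (fun v => c v == a) s = 1.

Definition conflict_free_vertex_connected (G : sgraph) (k : nat)
    (c : G -> 'I_k) : Prop :=
  forall x y : G, x != y -> exists2 p, is_path x y p & conflict_free c (x :: p).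

(* Used for connected [G] only; then an injective coloring with [#|G|] colors
   shows that the minimum exists. *)
Definition vcfc (G : sgraph) : nat :=
  least [set k | exists c : G -> 'I_k, conflict_free_vertex_connected c].

Definition log {R : realType} (b x : R) : R := (ln x / ln b)%R.

(* Main.v *)
(** Upper bound: every vertex set [S] of a tree has a vertex [v] such that each
    component of [T - v] contains at most half of [S].  Giving such a [v] a color
    of its own and recursing inside the components uses at most
    [1 + log_2 n] colors, and [2 ^ (k - 1) <= n] implies [(3 / 2) ^ k <= n] once
    [n >= 3].

    Lower bound: paths in a tree are unique, so along a longest path every
    contiguous subpath has a color occurring exactly once.  Hence the sets of
    colors occurring an odd number of times in the [d(T) + 2] prefixes of this
    path are pairwise distinct, and [d(T) + 2 <= 2 ^ k].  For an edge, the same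
    uniqueness shows that the coloring is proper. *)
Require Import Defs.
From HB Require Import structures.
From mathcomp Require Import all_boot all_order all_algebra.
From mathcomp Require Import all_classical reals exp.
From mathcomp Require Import zify lra.

Set Implicit Arguments.
Unset Strict Implicit.
Unset Printing Implicit Defensive.

Import Order.TTheory GRing.Theory Num.Theory.

Lemma leastP (P : set nat) (k : nat) : P k -> P (least P) /\ least P <= k.
Proof.
move=> Pk.
have exP : exists k, `[< P k >] by exists k; apply/asboolP.
have [m /asboolP Pm mle] := ex_minnP exP.
have /(xgetPex 0)[Pl lle] :
    exists m, [set k | P k /\ forall j, P j -> k <= j]%classic m.
  by exists m; split=> // j Pj; apply: mle; apply/asboolP.
by split=> //; apply: lle.
Qed.

(** Two prefixes with the same set of odd colors would leave a factor between them in which every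
    color occurs an even number of times, hence none exactly once. *)
Lemma size_conflict_free_factors (T : Type) (k : nat) (c : T -> 'I_k)
    (s : seq T) :
  (forall t1 t t2, s = t1 ++ t ++ t2 -> 0 < size t ->
     exists a, count (fun v => c v == a) t = 1) ->
  size s < 2 ^ k.
Proof.
move=> cf.
(* The empty prefix is counted too, which makes the bound strict. *)
pose F (i : 'I_(size s).+1) :=
  [set a | odd (count (fun v => c v == a) (take i s))].
suff injF : injective F.
  have := leq_card F injF.
  by rewrite card_ord -cardsT -powersetT card_powerset cardsT card_ord.
move=> i j Fij; apply/val_inj => /=.
wlog lt_ij : i j Fij / i < j.
  move=> W; case: (ltngtP i j) => // lt_ij; first exact: W.
  by apply/esym/W.
have take_j : take j s = take i s ++ drop i (take j s).
  by rewrite -[LHS](cat_take_drop i) take_takel // ltnW.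
have [||a cnt1] := cf (take i s) (drop i (take j s)) (drop j s).
- by rewrite catA -take_j cat_take_drop.
- by rewrite size_drop size_takel ?subn_gt0 // -ltnS.
- have /setP/(_ a) := Fij; rewrite !inE take_j count_cat cnt1 addn1 /=.
  by case: odd.
Qed.

(** Isolating [v] instead of removing it keeps the vertex type, so recursion into components never
    leaves [G]. *)
Definition adj_avoiding (G : sgraph) (v : G) : rel G :=
  [rel x y | [&& adj x y, x != v & y != v]].

(* The component of [x] in [G - v] when [x != v]. *)
Definition branch (G : sgraph) (v x : G) : {set G} :=
  [set y | connect (adj_avoiding v) x y].

Section Avoiding.
Variable G : sgraph.
Implicit Types (u v w x y z : G) (p q : seq G).

Lemma connect_avoiding_sym v : connect_sym (adj_avoiding v).
Proof.
by apply: sym_connect_sym => x y; rewrite /adj_avoiding /= adj_sym [(x != v) && _]andbC.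
Qed.

Lemma connect_avoiding_neq v x y :
  connect (adj_avoiding v) x y -> x != v -> y != v.
Proof.
move=> /connectP[p + ->]; elim: p x => //= z p IHp x /andP[/and3P[_ _ zv] pz] _.
exact: IHp.
Qed.

Lemma path_avoiding v x p :
  path (@adj G) x p -> v \notin x :: p -> path (adj_avoiding v) x p.
Proof.
elim: p x => //= y p IHp x /andP[xy py]; rewrite !inE !negb_or.
move=> /and3P[vx vy vp]; rewrite {1}/adj_avoiding /= xy eq_sym vx eq_sym vy IHp //.
by rewrite inE negb_or vy.
Qed.

Lemma avoiding_path v x p :
  path (adj_avoiding v) x p -> path (@adj G) x p.
Proof. by apply: sub_path => y z /= /and3P[]. Qed.

Lemma path_connect_avoiding v x p y :
  path (@adj G) x p -> v \notin x :: p -> y \in x :: p ->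
  connect (adj_avoiding v) x y.
Proof. by move=> xp vp; apply/path_connect/path_avoiding. Qed.

Lemma branch_eq v x y :
  connect (adj_avoiding v) x y -> branch v x = branch v y.
Proof.
move=> xy; apply/setP => z; rewrite !inE.
exact: same_connect (@connect_avoiding_sym v) _ _ xy _.
Qed.

Lemma branch_neighbor v x :
  connected G -> x != v -> exists2 u, adj v u & branch v x = branch v u.
Proof.
move=> /(_ v x)[[|u p] []] /=; first by move=> _ ->; rewrite eqxx.
move=> /andP[vu up] last_p /andP[vp _] _; exists u => //.
apply/esym/branch_eq/(path_connect_avoiding up vp).
by rewrite -last_p mem_last.
Qed.

End Avoiding.

(** * Acyclicity: unique paths and nested branches *)

Section Acyclic.
Variable G : sgraph.
Hypothesis acyclicG : acyclic G.
Implicit Types (u v w x y z : G) (p q : seq G).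

(** A nonempty simple path from [x] to [y] in [G - v] would close up through [v] to a cycle.
    Acyclicity enters only here. *)
Lemma neighbors_disconnected v x y :
  adj v x -> adj v y -> connect (adj_avoiding v) x y -> x = y.
Proof.
move=> vx vy /connectP[p0 xp0 last_p0].
case/shortenP: xp0 last_p0 => p xp uniq_p _ last_p.
have [p_nil|ne_p] := eqVneq p [::]; first by rewrite last_p p_nil.
have vNx : x != v by apply: contraTneq vx => ->; rewrite adj_irrefl.
have vNp : v \notin x :: p.
  by apply: contraL (eqxx v) => /(path_connect xp)/connect_avoiding_neq; apply.
case: (acyclicG (c := v :: x :: p)) => [|].
  by case: (p) ne_p.
rewrite /ucycle /= rcons_path vx (avoiding_path xp) -last_p adj_sym vy /=.
by rewrite vNp.
Qed.

(** The first steps of both paths are neighbors of [x], joined through [y] by the tails, which avoid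
    [x]; so they agree. *)
Lemma is_path_unique x y p q : is_path x y p -> is_path x y q -> p = q.
Proof.
elim: p x q => [|a p IHp] x [|b q] //= [pp lp up] [pq lq uq].
- by rewrite /= in lp lq; move: uq => /=; rewrite lp -lq mem_last.
- by rewrite /= in lp lq; move: up => /=; rewrite lq -lp mem_last.
rewrite /= in lp lq; case/andP: pp => xa pa; case/andP: pq => xb pb.
case/andP: up => xp up; case/andP: uq => xq uq.
have ab : a = b.
  apply: (neighbors_disconnected xa xb).
  apply: (@connect_trans _ _ y).
    by apply: (path_connect_avoiding pa xp); rewrite -lp mem_last.
  rewrite connect_avoiding_sym.
  by apply: (path_connect_avoiding pb xq); rewrite -lq mem_last.
by rewrite -ab in pb lq uq *; congr (_ :: _); apply: (IHp a).
Qed.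

(** For [y] in both branches, the path from [u] to [y] avoiding [v] would start with a neighbor of
    [u] other than [v] that is joined to [v] through [y] without meeting [u]. *)
Lemma branch_disjoint v u : adj v u -> [disjoint branch v u & branch u v].
Proof.
move=> vu; have vNu : v != u by apply: contraTneq vu => ->; rewrite adj_irrefl.
rewrite disjoint_subset; apply/fintype.subsetP => y; rewrite !inE.
move=> /connectP[p0 up0 last_p0].
case/shortenP: up0 last_p0 => [[|a p]] /=.
  move=> _ _ _ ->; apply: contraL (eqxx u) => /connect_avoiding_neq.
  exact.
move=> /andP[/and3P[ua _ aNv] ap] /andP[uNp _] _ last_p.
apply: contra_neqN aNv => vy; rewrite (@neighbors_disconnected u a v) ?eqxx // 1?adj_sym //.
apply: connect_trans (_ : connect _ a y) _; last by rewrite connect_avoiding_sym.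
by apply: path_connect_avoiding (avoiding_path ap) uNp _; rewrite last_p mem_last.
Qed.

(** A path from [w] avoiding [u] cannot meet [v], another neighbor of [u], so it extends back to [u]
    inside [branch v u]; [u] itself makes the inclusion strict. *)
Lemma branch_proper v u w :
  adj v u -> adj u w -> w != v -> branch u w \proper branch v u.
Proof.
move=> vu uw wNv.
have uNv : v != u by apply: contraTneq vu => ->; rewrite adj_irrefl.
have wNu : w != u by apply: contraTneq uw => ->; rewrite adj_irrefl.
apply/properP; split; last first.
  exists u; rewrite !inE ?connect0 //.
  by apply/negP => /connect_avoiding_neq/(_ wNu); rewrite eqxx.
apply/fintype.subsetP => y; rewrite !inE => /connectP[p wp ->].
apply: (@path_connect_avoiding _ _ _ (w :: p)); last by rewrite inE mem_last orbT.
  by rewrite /= uw (avoiding_path wp).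
rewrite inE negb_or uNv; apply: contra wNv => vp; apply/eqP.
apply: neighbors_disconnected uw _ (path_connect wp vp).
by rewrite adj_sym.
Qed.

(** * Balanced separators and the recursive coloring *)

Hypothesis connectedG : connected G.

(** Otherwise every vertex has a branch with more than half of [S]. Take such a branch with fewest
    vertices, starting at a neighbor [u] of [v], and a heavy branch at [u], starting at [w]: for
    [w = v] two disjoint branches each hold more than half of [S], else the new branch is
    smaller. *)
Lemma balanced_separator (r : G) (S : {set G}) :
  exists v, forall x, x != v -> 2 * #|S :&: branch v x| <= #|S|.
Proof.
apply: contrapT => /forallNP noSep.
pose heavy (e : G * G) :=
  (e.2 != e.1) && (#|S| < 2 * #|S :&: branch e.1 e.2|).
have heavyEx v : exists x, heavy (v, x).
  have /existsNP[x /not_implyP[xNv /negP big]] := noSep v.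
  by exists x; rewrite /heavy /= xNv ltnNge.
have [x0 h0] := heavyEx r.
have [[v x] /andP[/= xNv big] minvx] :=
  arg_minnP (fun e : G * G => #|branch e.1 e.2|) h0.
have [u vu Ebr] := branch_neighbor connectedG xNv.
have [y /andP[/= yNu bigu]] := heavyEx u.
have [w uw Ebr'] := branch_neighbor connectedG yNu.
have [wv|wNv] := eqVneq w v.
  rewrite Ebr in big; rewrite Ebr' wv in bigu.
  have := subset_leq_card (finset.subsetIl S (branch v u :|: branch u v)).
  rewrite finset.setIUr cardsU finset.setIACA.
  rewrite (disjoint_setI0 (branch_disjoint vu)) finset.setI0 cards0 subn0.
  by lia.
have := minvx (u, y); rewrite /heavy /= yNu bigu => /(_ isT).
by rewrite leqNgt Ebr Ebr' proper_card // branch_proper.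
Qed.

(** The separator [v] gets the top color [k], which occurs once on each path in [S] through [v]; a
    path missing [v] stays in one component, where the recursive coloring applies. *)
Lemma ranking (k : nat) (S : {set G}) : #|S| < 2 ^ k ->
  exists c : G -> nat, {in S, forall x, c x < k} /\
    forall x p, path (@adj G) x p -> uniq (x :: p) -> {subset x :: p <= S} ->
      exists2 a, a < k & count (fun v => c v == a) (x :: p) = 1.
Proof.
elim: k S => [|k IHk] S ltS.
  have S0 : S = finset.set0 by apply: cards0_eq; lia.
  by exists (fun=> 0); split=> [x|x p _ _ /(_ x)]; rewrite S0 ?inE ?eqxx // => /(_ isT).
have [r|noG] := pickP (@predT G); last first.
  by exists (fun=> 0); split=> x; have := noG x.
move=> _; have [v sep] := balanced_separator r S.
have /fin_all_exists[c cP] : forall r : G, exists c : G -> nat, r != v ->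
    {in S :&: branch v r, forall x, c x < k} /\
    forall x p, path (@adj G) x p -> uniq (x :: p) ->
      {subset x :: p <= S :&: branch v r} ->
      exists2 a, a < k & count (fun v => c v == a) (x :: p) = 1.
  move=> r'; have [->|rNv] := eqVneq r' v; first by exists (fun=> 0).
  have [|c cP] := IHk (S :&: branch v r'); last by exists c.
  by have := sep r' rNv; rewrite expnS in ltS; lia.
(* One representative per component, so that all its vertices use the same recursive coloring. *)
pose rt := fingraph.root (adj_avoiding v).
have rtP x : connect (adj_avoiding v) x (rt x) by apply: connect_root.
have rtNv x : x != v -> rt x != v by apply/connect_avoiding_neq/rtP.
have in_branch x : x \in branch v (rt x) by rewrite inE connect_avoiding_sym.
pose d x := if x == v then k else c (rt x) x.
have ltd x : x \in S -> x != v -> d x < k.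
  move=> xS xNv; rewrite /d (negPf xNv).
  by have [-> //] := cP (rt x) (rtNv x xNv); rewrite inE xS in_branch.
exists d; split=> [x xS|x p xp uniq_p pS].
  have [->|xNv] := eqVneq x v; first by rewrite /d eqxx.
  exact/ltnW/ltd.
have [vp|vNp] := boolP (v \in x :: p).
  exists k => //; rewrite (@eq_in_count _ _ (pred1 v)).
    by rewrite count_uniq_mem // vp.
  move=> y yp /=; have [->|yNv] := eqVneq y v; first by rewrite /d !eqxx.
  by rewrite ltn_eqF // ltd // pS.
have xNv : x != v by apply: contraNneq vNp => <-; rewrite mem_head.
have rtp y : y \in x :: p -> rt y = rt x.
  move=> yp; apply/esym/eqP; rewrite /rt root_connect; last exact: connect_avoiding_sym.
  exact: path_connect_avoiding yp.
have [_ /(_ x p xp uniq_p)] := cP (rt x) (rtNv x xNv).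
case=> [y yp|a ak cnt]; first by rewrite inE pS //= -(rtp y yp) in_branch.
exists a; first exact: ltnW.
rewrite -cnt; apply: eq_in_count => y yp.
have /negPf yNv : y != v by apply: contraNneq vNp => <-.
by rewrite /d yNv (rtp y yp).
Qed.

Lemma conflict_free_coloring (k : nat) : 0 < k -> #|G| < 2 ^ k ->
  exists c : G -> 'I_k, conflict_free_vertex_connected c.
Proof.
case: k => // k _; rewrite -cardsT => /ranking[c [ck cP]].
exists (fun x => inord (c x)) => x y _.
have [p pP] := connectedG x y; exists p => //.
have [xp _ uniq_p] := pP.
have [//|a ak cnt] := cP x p xp uniq_p; first by move=> z _; rewrite inE.
exists (inord a); rewrite -cnt; apply: eq_count => z.
by rewrite -val_eqE /= !inordK // ck // inE.
Qed.

Section LowerBounds.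
Variables (k : nat) (c : G -> 'I_k).
Hypothesis cfc : conflict_free_vertex_connected c.

(** By uniqueness the path that [cfc] provides is [p] itself; [cfc] says nothing for [x = y], where
    [p] is empty. *)
Lemma conflict_free_is_path x y p : is_path x y p -> conflict_free c (x :: p).
Proof.
move=> xp; have [xy|xNy] := eqVneq x y; last first.
  by have [q xq] := cfc xNy; rewrite (is_path_unique xp xq).
rewrite -{}xy in xp; have -> : p = [::].
  by apply: (is_path_unique xp); split.
by exists (c x); rewrite /= eqxx.
Qed.

Lemma conflict_free_proper : proper_coloring c.
Proof.
move=> x y xy; have xNy : x != y.
  by apply: contraTneq xy => ->; rewrite adj_irrefl.
have [|a] := @conflict_free_is_path x y [:: y].
  by split; rewrite //= ?xy // inE xNy.
(* Equal colors would make every count on the edge 0 or 2. *)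
by rewrite /=; apply: contra_eq_neq => ->; case: (c y == a).
Qed.

Lemma conflict_free_size x y p : is_path x y p -> size p < 2 ^ k - 1.
Proof.
move=> [xp _ uniq_p].
(* Counting vertices instead of edges accounts for the [- 1]. *)
suff : size (x :: p) < 2 ^ k by rewrite /=; lia.
apply: (size_conflict_free_factors (c := c)) => t1 [|z t] t2 // Exp _.
apply: (@conflict_free_is_path z (last z t) t); split=> //.
  have : sorted (@adj G) (x :: p) by [].
  by rewrite Exp => /cat_sorted2[_ /cat_sorted2[]].
by move: uniq_p; rewrite Exp !cat_uniq => /and3P[_ _ /and3P[]].
Qed.

End LowerBounds.

Lemma diameter_path : 0 < #|G| ->
  exists x y p, is_path x y p /\ size p = diameter G.
Proof.
move=> G0; rewrite /diameter.
have [x ->] := bigop.eq_bigmax (fun x : G => \max_y dist x y) G0.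
have [y ->] := bigop.eq_bigmax (fun y : G => dist x y) G0.
have [p xp] := connectedG x y.
have [[q xq size_q] _] := @leastP [set k | exists2 p, is_path x y p & size p = k]%classic
  (size p) (ex_intro2 _ _ p xp erefl).
by exists x, y, q; split=> //; apply: size_q.
Qed.

End Acyclic.

(** The cases [k = 0] and [k = 1] rest on [3 <= n]. From [27/8 <= 4] at [k = 2] on, each step
    multiplies the power of [3/2] by [3/2] and [2 ^ k] by 2. *)
Lemma expn_three_halves (R : realType) (k n : nat) :
  3 <= n -> 2 ^ k <= n -> ((3 / 2 : R) ^+ k.+1 <= n%:R)%R.
Proof.
move=> n3; rewrite -(ler_nat R) natrX => kn.
have {}n3 : (3%:R <= n%:R :> R)%R by rewrite ler_nat.
case: k kn => [|[|k]] kn; first by rewrite expr1; lra.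
  by rewrite expr2; lra.
apply: le_trans kn; elim: k => [|k IHk]; first by rewrite !exprS expr0; lra.
rewrite exprS [leRHS]exprS; apply: ler_pM => //; first by lra.
- by rewrite exprn_ge0 //; lra.
- by lra.
Qed.

Local Open Scope ring_scope.

Theorem theorem6 (R : realType) (T : sgraph) (n : nat)
    (hT : is_tree T) (hn : #|T| = n) (hn3 : (3 <= n)%N) :
  Num.max (chromatic_number T)%:Z
          (Num.ceil (log (2 : R) (diameter T + 1)%:R)) <= (vcfc T)%:Z /\
  (vcfc T)%:R <= log (3 / 2 : R) n%:R.
Proof.
have [connT acT] := hT.
(* The number of colors comes from [n < 2 ^ (trunc_log 2 n).+1]. *)
have [c0 cfc0] : exists c : T -> 'I_(trunc_log 2 n).+1,
    conflict_free_vertex_connected c.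
  by apply: conflict_free_coloring; rewrite ?hn ?trunc_log_ltn.
have [[c cfc] vcfc_le] := @leastP
  [set k | exists c : T -> 'I_k, conflict_free_vertex_connected c]%classic _
  (ex_intro _ c0 cfc0).
rewrite -/(vcfc T) in c cfc vcfc_le.
split.
  rewrite ge_max; apply/andP; split.
    rewrite lez_nat; apply: (@leastP [set k | exists c : T -> 'I_k, _]%classic _ _).2.
    by exists c; apply: conflict_free_proper.
  (* An integer bounds the ceiling once it bounds the logarithm, which leaves
     [diameter T + 1 <= 2 ^ vcfc T]. *)
  rewrite ceil_le_int /log ler_pdivrMr ?ln_gt0 ?ltr1n //.
  have [|x [y [p [xp <-]]]] := diameter_path connT; first by rewrite hn; lia.
  have := conflict_free_size acT cfc xp.
  rewrite -pmulrn mulr_natl -lnXn // ler_ln ?posrE ?exprn_gt0 ?ltr0n ?addn1 //.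
  by rewrite -natrX ler_nat; lia.
have ln32 : 0 < ln (3 / 2 : R) by rewrite ln_gt0 //; lra.
rewrite /log ler_pdivlMr // [leLHS]mulr_natl -lnXn; last by lra.
rewrite ler_ln ?posrE; last by rewrite ltr0n; lia.
  2: by rewrite exprn_gt0 //; lra.
apply: (@le_trans _ _ ((3 / 2) ^+ (trunc_log 2 n).+1)).
  by apply: ler_weXn2l => //; lra.
by apply: expn_three_halves => //; apply: trunc_logP => //; lia.
Qed.
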